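(* For every prime $p\geq3$, \[ 2^p=2+\sum_{k\geq0}(-1)^{k+1}p^{k+1}H_{p-1}(\overline{1},1^k), \] where $H_{p-1}(\overline1,1^k)=\sum_{p-1\geq n_1>n_2>\cdots>n_{k+1}\geq1}\frac{(-1)^{n_1}}{n_1n_2\cdots n_{k+1}}$.
   Context: Here $1^k$ denotes $k$ consecutive entries equal to $1$; the sum on the right is finite since $H_{p-1}(\overline1,1^k)=0$ when $k+1>p-1$. *)

(* Defs.v *)
From mathcomp Require Import all_boot all_order all_algebra.
From mathcomp Require Import classical_sets fsbigop.

Set Implicit Arguments.
Unset Strict Implicit.
Unset Printing Implicit Defensive.

Import GRing.Theory.
Local Open Scope ring_scope.

(* The alternating multiple harmonic sum H_N(\bar 1, 1^k): the index is the
   (k+1)-tuple (n_1, ..., n_(k+1)) with N >= n_1 > ... > n_(k+1) >= 1, encoded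
   with entries in 'I_N.+1 = {0, ..., N}; thead n is n_1. *)
Definition Hbar1 (N k : nat) : rat :=
  \sum_(n : k.+1.-tuple 'I_N.+1 |
          sorted gtn [seq val i | i <- n] && all (fun i : 'I_N.+1 => (0 < i)%N) n)
     (-1) ^+ (thead n : nat) / \prod_(j < k.+1) (tnth n j : nat)%:R.

(* Main.v *)
(* By the binomial theorem 2 ^ p - 2 is the sum of C(p, n) over 0 < n < p, and
   C(p, n) = (p / n) * C(p - 1, n - 1)
           = - (p / n) * (-1) ^ n * \prod_(0 < j < n) (1 - p / j).
   Expanding the last product in powers of p gives the multiple harmonic sums. *)
Require Import Defs.
From mathcomp Require Import all_boot all_order all_algebra.
From mathcomp Require Import classical_sets fsbigop.
From mathcomp Require Import ring.

Import GRing.Theory Num.Theory.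
Local Open Scope classical_set_scope.
Local Open Scope ring_scope.

Lemma big_tupleS (V : nmodType) (T : finType) (k : nat)
    (P : pred (k.+1.-tuple T)) (F : k.+1.-tuple T -> V) :
  \sum_(t | P t) F t =
  \sum_(x : T) \sum_(t : k.-tuple T | P (cons_tuple x t)) F (cons_tuple x t).
Proof.
rewrite pair_big_dep /= (reindex (fun u => cons_tuple u.1 u.2)) //=.
exists (fun t => (thead t, [tuple of behead t])) => [[x t] _|t _] /=.
  by congr (_, _); apply: val_inj.
by rewrite [in RHS](tuple_eta t); apply: val_inj.
Qed.

(* The elementary symmetric polynomial e_k(1, 1/2, ..., 1/(m-1)) when
   0 < m <= M. *)
Definition harm_sum (M m k : nat) : rat :=
  \sum_(t : k.-tuple 'I_M |
          path gtn m [seq val i | i <- t] && all (fun i : 'I_M => (0 < i)%N) t)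
     (\prod_(j < k) (tnth t j : nat)%:R)^-1.

Lemma harm_sum0 (M m : nat) : harm_sum M m 0 = 1.
Proof.
rewrite /harm_sum (big_pred1 [tuple]) => [|t]; last by rewrite tuple0 /= eqxx.
by rewrite big_ord0 invr1.
Qed.

Lemma prod_cons_tuple (R : comPzRingType) (M k : nat) (x : 'I_M)
    (t : k.-tuple 'I_M) :
  \prod_(j < k.+1) (tnth (cons_tuple x t) j : nat)%:R =
  (x : nat)%:R * \prod_(j < k) (tnth t j : nat)%:R :> R.
Proof.
by rewrite big_ord_recl tnth0; congr (_ * _); apply: eq_bigr => j _; rewrite tnthS.
Qed.

(** Split off the head [x], the largest index; the remaining ones lie below it. The bound [m <= M]
    ensures that every [x < m] occurs in ['I_M]. *)
Lemma harm_sumS (M m k : nat) : (0 < m <= M)%N ->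
  harm_sum M m k.+1 = \sum_(1 <= x < m) x%:R^-1 * harm_sum M x k.
Proof.
move=> /andP[m0 mM]; rewrite /harm_sum big_tupleS.
rewrite big_geq_mkord.
rewrite (big_ord_widen_cond M (leq 1) (fun x => x%:R^-1 * harm_sum M x k) mM).
rewrite [RHS]big_mkcond.
apply: eq_bigr => x _; case: ifPn => [/andP[x0 xm]|xN].
  rewrite mulr_sumr; apply: eq_big => [t|t _] /=; first by rewrite xm x0.
  by rewrite prod_cons_tuple invfM.
apply: big_pred0 => t /=; apply/negbTE; apply: contra xN.
by case/andP => /andP[-> _] /andP[-> _].
Qed.

Lemma harm_sum_eq0 (M m k : nat) : (0 < m <= M)%N -> (m <= k)%N ->
  harm_sum M m k = 0.
Proof.
elim: k m => [|k IHk] m; first by case: m.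
move=> /andP[m0 mM] mk; rewrite harm_sumS ?m0 // big_nat.
apply: big1 => x /andP[x0 xm].
rewrite IHk ?mulr0 ?x0 ?(ltnW (leq_trans xm mM)) //.
by rewrite -ltnS (leq_trans xm mk).
Qed.

(** Generating function of the elementary symmetric polynomials of the m - 1 numbers 1/j; stopping
    at [K >= m] drops only vanishing terms. *)
Lemma harm_sum_gen (M m K : nat) (q : rat) : (0 < m <= M)%N -> (m <= K)%N ->
  \sum_(k < K) q ^+ k * harm_sum M m k = \prod_(1 <= j < m) (1 + q / j%:R).
Proof.
elim: K m => [|K IHK] m; first by case: m.
move=> /andP[m0 mM] mK; rewrite big_ord_recl expr0 mul1r harm_sum0.
(* With P(x) the product over 0 < j < x, this reads (q / x) P(x) = P(x + 1) - P(x); summing over 0 <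
   x < m gives P(m) - 1. *)
have tele x : (0 < x)%N -> q / x%:R * \prod_(1 <= j < x) (1 + q / j%:R) =
    \prod_(1 <= j < x.+1) (1 + q / j%:R) - \prod_(1 <= j < x) (1 + q / j%:R).
  by move=> x0; rewrite big_nat_recr //=; ring.
transitivity (1 + \sum_(1 <= x < m) q / x%:R * \prod_(1 <= j < x) (1 + q / j%:R)).
  congr (_ + _).
  under eq_bigr => k _ do rewrite exprS harm_sumS ?m0 // mulr_sumr.
  (* For a fixed largest index [x], the sum over [k] is the induction hypothesis at [x < m], which
     gives P(x). *)
  rewrite exchange_big /= [LHS]big_nat [RHS]big_nat.
  apply: eq_bigr => x /andP[x0 xm].
  rewrite -IHK ?x0 ?(ltnW (leq_trans xm mM)) //; last first.
    by rewrite -ltnS (leq_trans xm mK).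
  by rewrite mulr_sumr; apply: eq_bigr => k _; ring.
rewrite (telescope_sumr_eq (fun x => \prod_(1 <= j < x) (1 + q / j%:R))) //.
  by rewrite [X in _ - X]big_geq // addrC subrK.
by move=> x /andP[x0 _]; rewrite tele.
Qed.

Lemma Hbar1E (N k : nat) :
  Hbar1 N k = \sum_(1 <= n < N.+1) (-1) ^+ n / n%:R * harm_sum N.+1 n k.
Proof.
rewrite /Hbar1 big_tupleS big_geq_mkord [RHS]big_mkcond /=.
apply: eq_bigr => x _; case: ifPn => _.
  rewrite /harm_sum mulr_sumr; apply: eq_big => [t|t _] /=; first by [].
  by rewrite prod_cons_tuple invfM mulrA theadE.
by apply: big_pred0 => t; rewrite /= andbF.
Qed.

Lemma Hbar1_eq0 (N k : nat) : (N <= k)%N -> Hbar1 N k = 0.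
Proof.
move=> Nk; rewrite Hbar1E big_nat; apply: big1 => n /andP[n0 nN].
by rewrite harm_sum_eq0 ?mulr0 ?n0 ?(ltnW nN) // (leq_trans _ Nk).
Qed.

(** C(p - 1, n) is the product of (p - j) / j = -(1 - p / j) over 0 < j <= n, built up one factor at
    a time. *)
Lemma bin_prod (p n : nat) : (n < p)%N ->
  'C(p.-1, n)%:R = (-1) ^+ n * \prod_(1 <= j < n.+1) (1 - p%:R / j%:R) :> rat.
Proof.
elim: n => [|n IHn] np; first by rewrite bin0 big_geq // mulr1.
have n0 : n.+1%:R != 0 :> rat by rewrite pnatr_eq0.
rewrite big_nat_recr //= exprS.
apply: (mulfI n0); rewrite -natrM mul_bin_left natrM IHn ?(ltnW np) //.
have -> : (p.-1 - n)%:R = p%:R - n.+1%:R :> rat.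
  by rewrite -natrB ?(ltnW np) //; case: p {IHn} np => // p _; rewrite subSS.
by field; rewrite nat1r.
Qed.

Lemma bin_harm_sum (p n : nat) : (0 < n < p)%N ->
  'C(p, n)%:R = \sum_(k < p.-1)
    (-1) ^+ k.+1 * p%:R ^+ k.+1 * ((-1) ^+ n / n%:R * harm_sum p n k) :> rat.
Proof.
case: p n => [|p] [|n] // np; rewrite /=.
have n0 : n.+1%:R != 0 :> rat by rewrite pnatr_eq0.
transitivity (p.+1%:R / n.+1%:R * (-1) ^+ n *
    \prod_(1 <= j < n.+1) (1 - p.+1%:R / j%:R) : rat).
  apply: (mulfI n0); rewrite -natrM -mul_bin_diag natrM -/(p.+1.-1).
  by rewrite bin_prod ?(ltnW np) //; field; rewrite nat1r.
(* Read 1 - p / j as 1 + (-p) / j to expand with q = -p. The cutoff p - 1 suffices for every 0 < n <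
   p, so it does not depend on n. *)
under eq_bigr => j _ do rewrite -mulNr.
rewrite -(@harm_sum_gen p.+1 n.+1 p) ?(ltnW np) // mulr_sumr.
apply: eq_bigr => k _; rewrite (exprNn p.+1%:R) !exprS; field.
by rewrite nat1r.
Qed.

(* \sum_(k \in [set: nat]) is the library's sum of a finitely supported family
   (its value is 0 if the support is infinite). *)
Theorem theorem6 (p : nat) (p_prime : prime p) (p_ge3 : (3 <= p)%N) :
  2 ^+ p = 2 + \sum_(k \in [set: nat]) (-1) ^+ k.+1 * p%:R ^+ k.+1 * Hbar1 p.-1 k
    :> rat.
Proof.
have p0 : (0 < p)%N by rewrite (leq_trans _ p_ge3).
(* The terms with k >= p - 1 vanish, so the sum becomes an ordinary finite one and can be exchanged
   with the sum over n. *)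
rewrite -(@fsbig_widen _ _ _ _ `I_p.-1) //=; last first.
  by move=> k [_ /negP]; rewrite -leqNgt => pk /=; rewrite Hbar1_eq0 ?mulr0.
rewrite -fsbig_ord.
under eq_bigr => k _ do rewrite Hbar1E mulr_sumr prednK //.
rewrite exchange_big /=.
under eq_big_nat => n hn do rewrite -bin_harm_sum //.
rewrite -natrX -[2%N]/(1 + 1)%N expnDn.
rewrite -(big_mkord xpredT (fun n => 'C(p, n) * (1 ^ (p - n) * 1 ^ n))%N).
(* The end terms n = p and n = 0 of the expansion of (1 + 1)^p are both 1 and give the isolated
   2. *)
rewrite big_nat_recr // big_ltn //= bin0 binn !exp1n !natrD natr_sum.
under eq_bigr => n _ do rewrite !exp1n !muln1.
by ring.
Qed.
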